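(* Let $k\ge 1$ and let $n\ge k-1$ be integers. Then the total number of standard Young tableaux of skew shape $\lambda/(k-1)$, summed over all partitions $\lambda$ of $n$ having at most three parts (and containing the one-row partition $(k-1)$), filled with the numbers $1,2,\ldots,n-k+1$, equals \[\sum_{i} r_{k,i}\, M_{i+n-k+1},\] where $M_m$ denotes the $m$th Motzkin number and the integers $r_{k,i}$ are defined by \[\sum_{k=1}^\infty r_k(x)y^k=\sum_{k=1}^\infty\sum_{i=0}^{k-1} r_{k,i}x^iy^k=\frac{y}{(1-y)\big(1+(1-x)y+y^2\big)}.\]
   Context: A partition $\lambda=(\lambda_1,\ldots,\lambda_l)$ of $n$ is a weakly decreasing sequence of positive integers summing to $n$; its parts are the $\lambda_i$. For partitions $\mu\subset\lambda$ (i.e. $\mu_i\le\lambda_i$ for all $i$), a standard Young tableau of skew shape $\lambda/\mu$ is a filling of the boxes of the Young diagram of $\lambda$ not in the Young diagram of $\mu$ with the numbers $1,2,\ldots,|\lambda|-|\mu|$, each used once, so that entries increase from left to right along rows and from top to bottom down columns. The Motzkin numbers are $M_m=\sum_{j=0}^{\lfloor m/2\rfloor}\frac{m!}{j!(j+1)!(m-2j)!}$, with generating function $\sum_{m\ge0}M_mx^m=\frac{1-x-\sqrt{1-2x-3x^2}}{2x^2}$. *)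

(* Defs.v *)
From HB Require Import structures.
From mathcomp Require Import all_boot all_order all_algebra.
Unset Strict Implicit. Unset Printing Implicit Defensive.
Import GRing.Theory Num.Theory.

Definition motzkin (m : nat) : nat :=
  \sum_(j < (m./2).+1) m`! %/ (j`! * (j.+1)`! * (m - 2 * j)`!).

(* A partition is represented by the seq of its parts (weakly decreasing,
   positive).  Rows are indexed from 0; row i of la has (nth 0 la i) boxes. *)

Definition in_skew (la mu : seq nat) (i j : nat) : bool :=
  (j < nth 0 la i) && (nth 0 mu i <= j).

(* number of boxes of la/mu (when mu is contained in la) *)
Definition skew_size (la mu : seq nat) : nat := sumn la - sumn mu.

(* A filling of la/mu: a function on the cells of the bounding box of la
   with values in {0,...,N}, N = |la| - |mu|.  It is a standard Young
   tableau iff: cells outside la/mu get 0 (irrelevant padding), the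
   entries on la/mu are pairwise distinct, lie in {1..N}, every value in
   {1..N} is used, rows increase left to right and columns increase top
   to bottom. *)
Definition cellT (la : seq nat) := ('I_(size la) * 'I_(head 0 la))%type.

Definition is_syt (la mu : seq nat)
  (f : {ffun 'I_(size la) * 'I_(head 0 la) -> 'I_(skew_size la mu).+1}) : bool :=
  [forall c : cellT la, ~~ in_skew la mu (val c.1) (val c.2) ==> (val (f c) == 0%N)] &&
  [forall c : cellT la, in_skew la mu (val c.1) (val c.2) ==> (0 < val (f c))%N] &&
  [forall c : cellT la, forall d : cellT la, (in_skew la mu (val c.1) (val c.2) && in_skew la mu (val d.1) (val d.2)
                        && (f c == f d)) ==> (c == d)] &&
  [forall v : 'I_(skew_size la mu).+1, (0 < val v)%N ==>
       [exists c : cellT la, in_skew la mu (val c.1) (val c.2) && (f c == v)]] &&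
  [forall c : cellT la, forall d : cellT la, (in_skew la mu (val c.1) (val c.2) && in_skew la mu (val d.1) (val d.2)
       && (val c.1 == val d.1) && (val c.2 < val d.2)%N) ==> (val (f c) < val (f d))%N] &&
  [forall c : cellT la, forall d : cellT la, (in_skew la mu (val c.1) (val c.2) && in_skew la mu (val d.1) (val d.2)
       && (val c.2 == val d.2) && (val c.1 < val d.1)%N) ==> (val (f c) < val (f d))%N].

Definition nsyt (la mu : seq nat) : nat := #|[pred f | @is_syt la mu f]|.

Definition part3 (a b c : nat) : seq nat := [seq x <- [:: a; b; c] | (0 < x)%N].

Section RGF.
Local Open Scope ring_scope.

(* The denominator (1 - y)(1 + (1 - x) y + y^2) as a polynomial in y
   with coefficients in Z[x]; 'X is y and ('X)%:P is x. *)
Definition rden : {poly {poly int}} :=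
  ((1 - 'X) * (1 + (1 - ('X)%:P) * 'X + 'X ^+ 2))%R.

(* r : nat -> {poly int} (r k = r_k(x), with r_0 = 0) has generating function
   sum_k r_k(x) y^k = y / rden, i.e. (sum_k r_k y^k) * rden = y as formal
   power series in y over Z[x]: compare the coefficients of y^m. *)
Definition r_gf_spec (r : nat -> {poly int}) : Prop :=
  forall m : nat, \sum_(j < m.+1) (r (m - j)%N * rden`_j)%R = ((m == 1%N)%:R)%R.

End RGF.

(* Main.v *)
Require Import Defs.
From HB Require Import structures.
From mathcomp Require Import all_boot all_order all_algebra.
From mathcomp Require Import zify ring.
Import GRing.Theory Num.Theory.

(* Removing the entry 1 shows that the tableaux of shape la/mu, summed over la,
   are counted by walks that add one box at a time to mu.  These depend only on
   p = mu_1 - mu_2 and q = mu_2 - mu_3, i.e. they are N-step walks in the Weyl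
   chamber of sl_3 with steps (1,0), (-1,1), (0,-1).  The transfer operator A of
   these walks commutes with its transpose A*, and A 1 = A* 1, hence
   A^N 1 = A*^N 1: both one-step recurrences hold for the number W_N(p,q) of
   walks.  Comparing them along q = 0 gives
     W_(N+1)(p,0) - W_(N+1)(p-1,0) = W_N(p+1,0) - W_N(p-2,0),
   so the differences W_N(p,0) - W_N(p-1,0) satisfy the recurrence of Motzkin
   paths from height p to 0; in particular W_N(0,0) is a Motzkin number.  The
   same comparison is W_N(p,0) = W_(N+1)(p-1,0) - W_(N+1)(p-2,0) + W_N(p-3,0),
   which is the recurrence r_(k+3) = x r_(k+2) - x r_(k+1) + r_k once x^i is
   evaluated to the Motzkin number M_(N+i). *)

(** * Linear extensions, counted by removing the entry 1 *)

Section LinearExtensions.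
Variables (C : finType) (e : rel C).
Implicit Types (S : {set C}) (c d x : C).

(** The value 0 marks the elements outside [S], so an extension is a function on all of [C]; one can
    exist only if [S] has [N] elements. *)
Definition lin_ext N S (f : {ffun C -> 'I_N.+1}) : bool :=
  [&& [forall c, (c \in S) == (0 < f c)],
      [forall c in S, forall d in S, (f c == f d) ==> (c == d)],
      [forall v : 'I_N.+1, (0 < v) ==> [exists c in S, f c == v]] &
      [forall c in S, forall d in S, e c d ==> (f c < f d)]].

Lemma lin_extP N S (f : {ffun C -> 'I_N.+1}) :
  reflect [/\ forall c, (c \in S) = (0 < f c),
              {in S &, injective f},
              forall v : 'I_N.+1, 0 < v -> exists2 c, c \in S & f c = v &
              {in S &, forall c d, e c d -> f c < f d}]
          (lin_ext N S f).
Proof.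
apply: (iffP and4P) => [] [f0 finj fsurj fmon]; split.
- by move=> c; apply/eqP/(forallP f0).
- move=> c d cS dS fcd; apply/eqP.
  by move/forall_inP/(_ c cS)/forall_inP/(_ d dS)/implyP: finj; apply; apply/eqP.
- move=> v v0; have /implyP/(_ v0)/exists_inP[c cS /eqP fc] := forallP fsurj v.
  by exists c.
- move=> c d cS dS ecd.
  by move/forall_inP/(_ c cS)/forall_inP/(_ d dS)/implyP: fmon; apply.
- by apply/forallP => c; rewrite f0.
- apply/forall_inP => c cS; apply/forall_inP => d dS; apply/implyP => /eqP fcd.
  exact/eqP/finj.
- apply/forallP => v; apply/implyP => /fsurj[c cS fc].
  by apply/exists_inP; exists c => //; apply/eqP.
- apply/forall_inP => c cS; apply/forall_inP => d dS; apply/implyP.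
  exact: fmon.
Qed.

Definition nlin_ext N S : nat := #|[pred f | lin_ext N S f]|.

Definition minimal_in S x : bool := (x \in S) && [forall d in S, ~~ e d x].

Lemma nlin_ext0 : nlin_ext 0 set0 = 1.
Proof.
rewrite /nlin_ext -[RHS](exp1n #|C|) -[in RHS](card_ord 1) -card_ffun.
apply: eq_card => f; rewrite !inE; apply/lin_extP; split=> [c|c d|v|c d].
- by rewrite inE (ord1 (f c)).
- by rewrite inE.
- by rewrite (ord1 v).
- by rewrite inE.
Qed.

(* Shifting entries by one, a missing entry being 0, identifies the extensions
   with f x = 1 and those of S :\ x. *)
Let up N S (g : {ffun C -> 'I_N.+1}) : {ffun C -> 'I_N.+2} :=
  [ffun c => if c \in S then lift ord0 (g c) else ord0].
Let down N (f : {ffun C -> 'I_N.+2}) : {ffun C -> 'I_N.+1} :=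
  [ffun c => inord (f c).-1].

Lemma nlin_ext_fiber N S x : minimal_in S x ->
  \sum_(f | lin_ext N.+1 S f && (f x == 1 :> nat)) 1 = nlin_ext N (S :\ x).
Proof.
case/andP=> xS /forall_inP xmin.
rewrite (reindex_onto (up N S) (down N)); last first.
  move=> f /andP[/lin_extP[f0 _ _ _] _]; apply/ffunP => c; apply/ord_inj.
  rewrite !ffunE f0; case: posnP => [->//|fc].
  by rewrite lift0 inordK prednK // -ltnS.
have upS g c : c \in S -> up N S g c = (g c).+1 :> nat.
  by move=> cS; rewrite ffunE cS lift0.
have upN g c : c \notin S -> up N S g c = 0 :> nat.
  by move=> cS; rewrite ffunE (negPf cS).
rewrite sum1_card /nlin_ext; apply: eq_card => g; rewrite !inE.
have downK c : down N (up N S g) c = (if c \in S then g c : nat else 0) :> nat.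
  rewrite ffunE; case: ifP => [cS|/negbT cS]; last by rewrite upN //= inordK.
  by rewrite upS //= inordK.
apply/andP/lin_extP => [[/andP[/lin_extP[f0 finj fsurj fmon] /eqP fx] /eqP gK]|].
  have gN c : c \notin S -> g c = 0 :> nat.
    by move=> cS; rewrite -gK downK (negPf cS).
  have gx : g x = 0 :> nat by move: fx; rewrite upS // => -[].
  have ginj : {in S &, injective g}.
    move=> c d cS dS gcd; apply: finj => //.
    by apply/ord_inj; rewrite !upS // gcd.
  split.
  - move=> c; rewrite !inE; have [->|cx] /= := eqVneq c x; first by rewrite gx.
    have [cS|cS] := boolP (c \in S); last by rewrite gN.
    rewrite lt0n; apply/esym/eqP => gc; case/eqP: cx; apply: ginj => //.
    by apply/ord_inj; rewrite gc gx.
  - by move=> c d /setD1P[_ cS] /setD1P[_ dS]; apply: ginj.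
  - move=> v v0; have [|c cS /(congr1 (@nat_of_ord _))] := fsurj (lift ord0 v).
      by rewrite lift0.
    rewrite /= upS // /bump /= add1n => -[gc].
    exists c; last exact/ord_inj.
    by rewrite !inE cS andbT; apply: contraTneq v0 => cx; rewrite -gc cx gx.
  - move=> c d /setD1P[_ cS] /setD1P[_ dS] /(fmon _ _ cS dS).
    by rewrite !upS.
case=> g0 ginj gsurj gmon.
have gx : g x = 0 :> nat.
  by apply/eqP; rewrite -[_ == _]negbK -lt0n -g0 !inE eqxx.
have gS c : c \in S -> g c = 0 :> nat -> c = x.
  move=> cS gc; apply/eqP; have := g0 c.
  by rewrite !inE cS gc andbT => /negbFE.
split; last first.
  apply/eqP/ffunP => c; apply/ord_inj; rewrite downK; case: ifP => // cS.
  by apply/esym/eqP; rewrite -[_ == _]negbK -lt0n -g0 !inE cS andbF.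
rewrite upS // gx andbT; apply/lin_extP; split.
- move=> c; have [cS|cS] := boolP (c \in S); first by rewrite upS.
  by rewrite upN.
- move=> c d cS dS /(congr1 (@nat_of_ord _)) /=; rewrite !upS // => -[gcd].
  have [cx|cx] := eqVneq c x; first by rewrite cx (gS d) // -gcd cx.
  have [dx|dx] := eqVneq d x; first by rewrite dx (gS c) // gcd dx.
  by apply: ginj => //; rewrite ?inE ?cx ?dx //; apply/ord_inj.
- move=> v; case: (unliftP ord0 v) => [w ->|-> //] _.
  have [w0|w0] := posnP w.
    by exists x => //; apply/ord_inj; rewrite upS // gx lift0 w0.
  have [c /setD1P[_ cS] gc] := gsurj w w0.
  by exists c => //; apply/ord_inj; rewrite upS // gc.
- move=> c d cS dS ecd; rewrite !upS // ltnS.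
  (* Nothing in [S] precedes [x], so the larger element [d] keeps a positive entry after the
     shift. *)
  have dx : d != x by apply: contraTneq ecd => ->; apply: xmin.
  have dS' : d \in S :\ x by rewrite !inE dx.
  have [->|cx] := eqVneq c x; first by rewrite gx -g0.
  by apply: gmon => //; rewrite !inE cx.
Qed.

(** The entry 1 sits at exactly one element, minimal because entries increase along [e]; extensions
    are grouped by that element. *)
Lemma nlin_ext_rec N S :
  nlin_ext N.+1 S = \sum_(x | minimal_in S x) nlin_ext N (S :\ x).
Proof.
under eq_bigr => x xmin do rewrite -nlin_ext_fiber // big_mkcondr.
rewrite exchange_big /nlin_ext -sum1_card /=; apply: eq_bigr => f.
move=> /lin_extP[f0 finj fsurj fmon].
have [|x xS fx] := fsurj (inord 1); first by rewrite inordK.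
have {}fx : f x = 1 :> nat by rewrite fx inordK.
rewrite (bigD1 x) /=; last first.
  rewrite /minimal_in xS; apply/forall_inP => d dS.
  apply/negP => /(fmon _ _ dS xS).
  by rewrite fx ltnS leqn0 => /eqP fd; move: dS; rewrite f0 fd.
rewrite fx eqxx big1 ?addn0 // => y /andP[/andP[yS _] yx].
case: eqP => // fy; case/eqP: yx; apply: finj => //.
by apply/ord_inj; rewrite fx.
Qed.

End LinearExtensions.

(** * Skew tableaux as linear extensions, and growth of the inner shape *)

Section SkewShapes.
Implicit Types la mu : seq nat.

Definition skew_cells la mu : {set cellT la} :=
  [set c | in_skew la mu (val c.1) (val c.2)].

Definition cell_lt la : rel (cellT la) := fun c d =>
  ((c.1 == d.1) && (c.2 < d.2)) || ((c.2 == d.2) && (c.1 < d.1)).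

(** [N] is independent of the shapes, so that it can drop by one as the inner shape grows. *)
Definition nskew N la mu : nat := nlin_ext (cellT la) (cell_lt la) N (skew_cells la mu).

Lemma nsytE la mu : nsyt la mu = nskew (skew_size la mu) la mu.
Proof.
rewrite /nsyt /nskew /nlin_ext; apply: eq_card => f; rewrite !inE.
apply/idP/lin_extP => [|[f0 finj fsurj fmon]].
  rewrite /is_syt -!andbA => /and5P[fout fin finj fsurj /andP[frow fcol]]; split.
  - move=> c; rewrite inE; have [cS|cS] := boolP (in_skew _ _ _ _).
      by have /implyP/(_ cS) -> := forallP fin c.
    by have /implyP/(_ cS)/eqP -> := forallP fout c.
  - move=> c d; rewrite !inE => cS dS fcd; apply/eqP.
    by have /forallP/(_ d)/implyP := forallP finj c; apply; rewrite cS dS fcd /=.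
  - move=> v v0; have /implyP/(_ v0)/existsP[c /andP[cS /eqP fc]] := forallP fsurj v.
    by exists c; rewrite ?inE.
  - move=> c d; rewrite !inE => cS dS /orP[] /andP[/eqP E lt_cd].
      by have /forallP/(_ d)/implyP := forallP frow c; apply; rewrite cS dS E lt_cd eqxx.
    by have /forallP/(_ d)/implyP := forallP fcol c; apply; rewrite cS dS E lt_cd eqxx.
have fS c : in_skew la mu (val c.1) (val c.2) = (0 < f c) by rewrite -f0 inE.
rewrite /is_syt -!andbA; apply/and5P; split; last (apply/andP; split).
- by apply/forallP => c; rewrite fS lt0n negbK; apply/implyP.
- by apply/forallP => c; rewrite fS; apply/implyP.
- apply/forallP => c; apply/forallP => d; apply/implyP => /andP[/andP[cS dS] /eqP fcd].
  by apply/eqP/finj; rewrite ?inE.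
- apply/forallP => v; apply/implyP => /fsurj[c cS fc].
  by apply/existsP; exists c; rewrite inE in cS; rewrite cS fc /=.
- apply/forallP => c; apply/forallP => d.
  apply/implyP => /andP[/andP[/andP[cS dS] Ecd] lt_cd].
  by apply: fmon; rewrite ?inE // /cell_lt lt_cd -val_eqE Ecd.
- apply/forallP => c; apply/forallP => d.
  apply/implyP => /andP[/andP[/andP[cS dS] Ecd] lt_cd].
  by apply: fmon; rewrite ?inE // /cell_lt lt_cd -[c.2 == d.2]val_eqE Ecd orbT.
Qed.

Lemma eq_nskew N la mu mu' : nth 0 mu =1 nth 0 mu' -> nskew N la mu = nskew N la mu'.
Proof.
move=> Emu; rewrite /nskew; congr nlin_ext; apply/setP => c.
by rewrite !inE /in_skew Emu.
Qed.

Definition nonincr (s : seq nat) : Prop :=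
  forall i j, i <= j -> nth 0 s j <= nth 0 s i.

Definition addable la mu i : bool :=
  (nth 0 mu i < nth 0 la i) && ((i == 0) || (nth 0 mu i < nth 0 mu i.-1)).

(** A minimal cell is leftmost in its row of the skew shape and has no skew cell directly above it:
    it is a box that can be added to [mu]. *)
Lemma minimal_skew la mu (c : cellT la) : nonincr la -> nonincr mu ->
  minimal_in (cellT la) (cell_lt la) (skew_cells la mu) c =
  addable la mu c.1 && (c.2 == nth 0 mu c.1 :> nat).
Proof.
move=> dla dmu; case: c => i j; rewrite /minimal_in inE /in_skew /addable /=.
apply/idP/idP.
  case/andP=> /andP[j_la mu_j] /forall_inP cmin.
  have [mu_lt|j_mu] := ltnP (nth 0 mu i) j.
    have lt_h : nth 0 mu i < head 0 la by apply: ltn_trans mu_lt _.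
    have := cmin (i, Ordinal lt_h); rewrite inE /in_skew /= leqnn.
    rewrite (ltn_trans mu_lt j_la) => /(_ isT).
    by rewrite /cell_lt /= eqxx mu_lt.
  have Ej : j = nth 0 mu i :> nat by apply/eqP; rewrite eqn_leq j_mu.
  rewrite -Ej eqxx j_la andbT /=; case: (posnP i) => [//|i0] /=.
  rewrite ltnNge; apply/negP => le_mu.
  have lt_i : i.-1 < size la by apply: leq_ltn_trans (leq_pred _) _.
  have := cmin (Ordinal lt_i, j); rewrite inE /in_skew /= le_mu.
  rewrite (leq_trans j_la) ?dla ?leq_pred // => /(_ isT).
  by rewrite /cell_lt /= eqxx prednK // leqnn orbT.
case/andP=> /andP[mu_la row_ok] /eqP Ej.
rewrite Ej mu_la leqnn; apply/forall_inP => -[i' j'].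
rewrite inE /in_skew /= => /andP[_ mu_j'].
apply/negP; rewrite /cell_lt /= => /orP[] /andP[/eqP E lt_cd].
  by move: lt_cd; rewrite Ej -E ltnNge mu_j'.
move: row_ok; rewrite -Ej -E; case: posnP => [i0|i0 /=]; first by rewrite i0 in lt_cd.
rewrite ltnNge; case/negP; apply: leq_trans mu_j'; apply: dmu.
by rewrite -ltnS prednK.
Qed.

Lemma nskew_rec N la mu : nonincr la -> nonincr mu ->
  nskew N.+1 la mu =
  \sum_(i < size la) if addable la mu i then nskew N la (incr_nth mu i) else 0.
Proof.
move=> dla dmu; rewrite /nskew nlin_ext_rec.
rewrite (partition_big (fun c : cellT la => c.1) xpredT) //=.
apply: eq_bigr => i _; case: ifPn => [add_i|nadd_i]; last first.
  apply: big_pred0 => c; rewrite minimal_skew //.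
  by apply/negP => /andP[/andP[add_c _] /eqP E]; rewrite -E add_c in nadd_i.
have lt_h : nth 0 mu i < head 0 la.
  by rewrite -nth0; case/andP: add_i => /leq_trans + _; apply; apply: dla.
rewrite (big_pred1 (i, Ordinal lt_h)) => [|[i' j]]; last first.
  rewrite minimal_skew //= -pair_eqE /= -[j == _]val_eqE /= andbC.
  by have [->|//] := eqVneq i' i; rewrite add_i.
congr nlin_ext; apply/setP => -[i' j]; rewrite !inE /in_skew /= nth_incr_nth.
rewrite -pair_eqE /= -[j == _]val_eqE /= (eq_sym i' i) -val_eqE /=.
have [Ei|_] := eqVneq (i : nat) i'; last by [].
rewrite -Ei; lia.
Qed.

Lemma nskew0 la mu : (forall i, nth 0 la i <= nth 0 mu i) -> nskew 0 la mu = 1.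
Proof.
move=> sub; rewrite /nskew -(nlin_ext0 _ (cell_lt la)); congr nlin_ext.
apply/setP => c; rewrite !inE /in_skew; apply/negP => /andP[lt_la].
by rewrite leqNgt (leq_trans lt_la).
Qed.

(** The discarded zeros are trailing, and the default value 0 of [nth] restores them. *)
Lemma nth_part3 a b c i : c <= b -> b <= a ->
  nth 0 (part3 a b c) i = nth 0 [:: a; b; c] i.
Proof.
by case: a b c => [|a] [|b] [|c] //; case: i => [|[|[|[|i]]]].
Qed.

Lemma nonincr3 a b c : c <= b -> b <= a -> nonincr [:: a; b; c].
Proof.
move=> cb ba [|[|[|i]]] [|[|[|j]]] //= _; rewrite ?nth_nil //; lia.
Qed.

Lemma sumn_part3 a b c : sumn (part3 a b c) = a + b + c.
Proof. by case: a b c => [|a] [|b] [|c]; rewrite /= ?addn0 ?add0n ?addnA. Qed.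

Lemma nskew3_rec N a b c x y z : c <= b -> b <= a -> z <= y -> y <= x ->
  nskew N.+1 (part3 a b c) [:: x; y; z] =
    (if x < a then nskew N (part3 a b c) [:: x.+1; y; z] else 0) +
    (if (y < b) && (y < x) then nskew N (part3 a b c) [:: x; y.+1; z] else 0) +
    (if (z < c) && (z < y) then nskew N (part3 a b c) [:: x; y; z.+1] else 0).
Proof.
move=> cb ba zy yx.
have dla : nonincr (part3 a b c).
  by move=> i j ij; rewrite !nth_part3 //; apply: nonincr3.
rewrite nskew_rec //; last exact: nonincr3.
pose F i := if addable (part3 a b c) [:: x; y; z] i
            then nskew N (part3 a b c) (incr_nth [:: x; y; z] i) else 0.
(* Discarded rows read as length 0 and are never addable, so the sum may run over all three rows. *)
have size3 : size (part3 a b c) <= 3 by rewrite size_filter count_size.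
rewrite (big_ord_widen 3 F size3) big_mkcond !big_ord_recr big_ord0 /= add0n.
have FE i : (if i < size (part3 a b c) then F i else 0) = F i.
  case: ltnP => // size_i; rewrite /F /addable.
  by rewrite [nth 0 (part3 a b c) i]nth_default.
by rewrite !FE /F /addable !nth_part3 //= andbT.
Qed.

End SkewShapes.

(** * Walks in the Weyl chamber and Motzkin paths *)

Section ChamberWalks.

(* p and q are the differences between consecutive rows of the inner shape. *)
Fixpoint walks N p q : nat :=
  if N is N'.+1 then
    walks N' p.+1 q + (if p is p'.+1 then walks N' p' q.+1 else 0)
                    + (if q is q'.+1 then walks N' p q' else 0)
  else 1.

(* The recurrence for the reversed steps: the two transfer operators commute and
   agree on the constant function 1. *)
Lemma walks_dual N p q :
  walks N.+1 p q =
    walks N p q.+1 + (if q is q'.+1 then walks N p.+1 q' else 0)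
                   + (if p is p'.+1 then walks N p' q else 0).
Proof.
elim: N p q => [|N IHN] p q; first by case: p q => [|p] [|q].
have E r s : walks N.+1 r s = walks N r.+1 s +
    (if r is r'.+1 then walks N r' s.+1 else 0) +
    (if s is s'.+1 then walks N r s' else 0) by [].
have E' : walks N.+2 p q = walks N.+1 p.+1 q +
    (if p is p'.+1 then walks N.+1 p' q.+1 else 0) +
    (if q is q'.+1 then walks N.+1 p q' else 0) by [].
(* The left side expands by the dual recurrence [IHN], the right side by the defining one [E]; the
   cases treat the walls of the chamber. *)
rewrite {}E'; case: p q => [|p] [|q].
- by move: (IHN 1 0) (E 0 1); cbv match; lia.
- by move: (IHN 1 q.+1) (IHN 0 q) (E 0 q.+2) (E 1 q); cbv match; lia.
- by move: (IHN p.+2 0) (IHN p 1) (E p.+1 1) (E p 0); cbv match; lia.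
- move: (IHN p.+2 q.+1) (IHN p q.+2) (IHN p.+1 q).
  by move: (E p.+1 q.+2) (E p.+2 q) (E p q.+1); cbv match; lia.
Qed.

(* Motzkin paths of length N from height h to height 0. *)
Fixpoint mwalks N h : nat :=
  if N is N'.+1 then
    mwalks N' h + mwalks N' h.+1 + (if h is h'.+1 then mwalks N' h' else 0)
  else h == 0.

(** The term [walks N p.+1 1] is eliminated between the definition at [(p.+2, 0)] and the dual
    recurrence at [(p.+1, 0)]. *)
Lemma walks_row_step N p :
  walks N.+1 p.+2 0 + walks N p 0 = walks N.+1 p.+1 0 + walks N p.+3 0.
Proof. rewrite [walks N.+1 p.+1 0]walks_dual /=; ring. Qed.

Lemma walks_row N p : walks N p 0 = \sum_(h < p.+1) mwalks N h.
Proof.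
elim: N p => [|N IHN] p.
  by rewrite big_ord_recl big1 //= addn0.
have W0 : walks N.+1 0 0 = walks N 1 0 by rewrite /= !addn0.
have W1 : walks N.+1 1 0 = walks N.+1 0 0 + walks N 2 0.
  by rewrite [walks N.+1 0 0]walks_dual /=; ring.
(* The row recurrence first yields the value at 2, so 0 and 1 are both base cases. *)
suff: walks N.+1 p 0 = \sum_(h < p.+1) mwalks N.+1 h /\
      walks N.+1 p.+1 0 = \sum_(h < p.+2) mwalks N.+1 h by case.
elim: p => [|p [IHp IHp1]].
  by rewrite W1 W0 !IHN !big_ord_recr !big_ord0 /=; split; ring.
split=> //; rewrite big_ord_recr -IHp1.
apply: (@addIn (walks N p 0)); rewrite walks_row_step !IHN.
by rewrite !(big_ord_recr p.+1, big_ord_recr p.+2, big_ord_recr p.+3) /=; ring.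
Qed.

End ChamberWalks.

(** * Motzkin paths and the explicit Motzkin numbers *)

Section MotzkinNumbers.

(* The paths of mwalks with exactly u up steps. *)
Fixpoint mwalks_up N h u : nat :=
  if N is N'.+1 then
    mwalks_up N' h u + (if u is u'.+1 then mwalks_up N' h.+1 u' else 0)
                     + (if h is h'.+1 then mwalks_up N' h' u else 0)
  else (h == 0) && (u == 0).

Lemma sum_mwalks_up N K h : N < K -> \sum_(u < K) mwalks_up N h u = mwalks N h.
Proof.
elim: N K h => [|N IHN] [|K] h //= NK.
  by rewrite big_ord_recl big1 /= ?andbT ?addn0 // => i _; rewrite andbF.
rewrite !big_split /= IHN 1?ltnW //; congr (_ + _ + _).
  by rewrite big_ord_recl /= IHN.
by case: h => [|h]; rewrite ?IHN 1?ltnW // big1.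
Qed.

(** Going from height [h] to 0 with [u] up steps takes [u + h] down steps. *)
Lemma mwalks_up_eq0 N h u : N < 2 * u + h -> mwalks_up N h u = 0.
Proof.
elim: N h u => [|N IHN] h u /= lt_N; first by case: h u lt_N => [|h] [|u].
rewrite IHN ?(ltn_trans _ lt_N) //.
case: u h lt_N => [|u] [|h] //= lt_N; rewrite ?IHN //; lia.
Qed.

(** A ballot formula with denominators cleared, [k] being the number of level steps. By the first
    step, the induction reduces to k(h+1) + u(h+2) + (u+h+1)h = (2u+h+k)(h+1). *)
Lemma mwalks_up_fact N h u k : N = 2 * u + h + k ->
  mwalks_up N h u * (u`! * (u + h).+1`! * k`!) = N`! * h.+1.
Proof.
elim: N h u k => [|N IHN] h u k EN.
  by case: h u k EN => [|h] [|u] [|k].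
have -> : N.+1`! = (2 * u + h + k) * N`! by rewrite -EN factS.
rewrite /= mulnDl mulnDl.
have -> : mwalks_up N h u * (u`! * (u + h).+1`! * k`!) = k * (N`! * h.+1).
  case: k EN => [|k] EN; first by rewrite mwalks_up_eq0 //; lia.
  by rewrite -(IHN h u k) ?factS; lia.
have -> : (if u is u'.+1 then mwalks_up N h.+1 u' else 0) *
    (u`! * (u + h).+1`! * k`!) = u * (N`! * h.+2).
  case: u EN => [|u] EN //.
  rewrite -(IHN h.+1 u k); last lia.
  by rewrite addSnnS factS; lia.
have -> : (if h is h'.+1 then mwalks_up N h' u else 0) *
    (u`! * (u + h).+1`! * k`!) = (u + h).+1 * (N`! * h).
  case: h EN => [|h] EN; first by rewrite !muln0.
  rewrite -(IHN h u k); last lia.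
  by rewrite addnS [(_.+2)`!]factS; lia.
ring.
Qed.

Lemma mwalks0 N : mwalks N 0 = motzkin N.
Proof.
rewrite -(sum_mwalks_up N N.+1) // /motzkin.
have le_half : N./2.+1 <= N.+1 by lia.
rewrite (big_ord_widen _ (fun j => N`! %/ (j`! * j.+1`! * (N - 2 * j)`!)) le_half).
rewrite [RHS]big_mkcond; apply: eq_bigr => j _ /=.
case: ltnP => j_half; last by rewrite mwalks_up_eq0 //; lia.
have := mwalks_up_fact N 0 j (N - 2 * j); rewrite muln1 => <-; last lia.
by rewrite addn0 mulnK // !muln_gt0 !fact_gt0.
Qed.

End MotzkinNumbers.

(** * Tableaux with at most three rows as chamber walks *)

Section TableauxAndWalks.

Definition between3 n (m : nat * nat * nat) (la : nat * nat * nat) : bool :=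
  let: (x, y, z) := m in let: (a, b, c) := la in
  [&& c <= b, b <= a, a + b + c == n, x <= a, y <= b & z <= c].

(** Outer shapes are triples padded with zeros; the inner shape is a general triple because the
    recurrence moves it. *)
Definition ntab N n x y z : nat :=
  \sum_(p : 'I_n.+1 * 'I_n.+1 * 'I_n.+1)
    if between3 n (x, y, z) (p.1.1 : nat, p.1.2 : nat, p.2 : nat)
    then nskew N (part3 p.1.1 p.1.2 p.2) [:: x; y; z] else 0.

Lemma ntab0 x y z : z <= y -> y <= x -> ntab 0 (x + y + z) x y z = 1.
Proof.
move=> zy yx; have [n nE] : {n | n = x + y + z} by exists (x + y + z).
rewrite -nE; have [xn yn zn] : [/\ x < n.+1, y < n.+1 & z < n.+1] by split; lia.
rewrite /ntab (bigD1 (Ordinal xn, Ordinal yn, Ordinal zn)) //= zy yx !leqnn -nE eqxx /=.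
rewrite nskew0 => [|i]; last by rewrite nth_part3.
rewrite big1 // => -[[a b] c]; case: ifP => //= /and5P[_ _ /eqP En xa /andP[yb zc]].
case/eqP; congr (_, _, _); apply/ord_inj => /=; lia.
Qed.

Lemma ntab_rec N n x y z : z <= y -> y <= x -> x + y + z + N.+1 = n ->
  ntab N.+1 n x y z = ntab N n x.+1 y z + (if y < x then ntab N n x y.+1 z else 0)
                                        + (if z < y then ntab N n x y z.+1 else 0).
Proof.
move=> zy yx En.
have push (b : bool) m : (if b then m else 0) = b * m by case: b; rewrite ?mul1n.
rewrite !push /ntab !big_distrr -!big_split /=; apply: eq_bigr => -[[a b] c] _ /=.
have [cb|cb] := leqP c b; last by rewrite !muln0.
have [ba|ba] := leqP b a; last by rewrite !muln0.
rewrite !push; case: eqP => [Eabc|] /=; last by rewrite !muln0.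
rewrite nskew3_rec // !push.
(* The condition [x < a] for adding a box is the containment condition for the enlarged inner shape,
   and likewise in the other rows. *)
by case: (ltngtP x a) (ltngtP y b) (ltngtP z c) => [xa|xa|xa] [yb|yb|yb] [zc|zc|zc];
  rewrite /= ?muln0 ?mul0n ?mul1n ?addn0 //; lia.
Qed.

Lemma ntab_walks N n x y z : z <= y -> y <= x -> x + y + z + N = n ->
  ntab N n x y z = walks N (x - y) (y - z).
Proof.
elim: N x y z => [|N IHN] x y z zy yx En.
  by rewrite -En addn0 ntab0.
rewrite ntab_rec // [RHS]/= IHN; try lia.
rewrite subSn //; congr (_ + _ + _).
  case: ltnP => xy; last by have -> : x - y = 0 by lia.
  rewrite IHN //; try lia.
  by rewrite -(subnSK xy) subSn.
case: ltnP => yz; last by have -> : y - z = 0 by lia.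
rewrite IHN //; try lia.
by rewrite -(subnSK yz).
Qed.

End TableauxAndWalks.

Local Open Scope ring_scope.

(** * The polynomials [r k] evaluated at Motzkin numbers *)

Section MotzkinFunctional.
Variable r : nat -> {poly int}.
Hypothesis hr : r_gf_spec r.

Lemma rdenE : rden = 1 - ('X)%:P * 'X + ('X)%:P * 'X^2 - 'X^3.
Proof. by rewrite /rden; ring. Qed.

Lemma coef_rden j :
  rden`_j = (j == 0%N)%:R - (j == 1%N)%:R * 'X + (j == 2)%:R * 'X - (j == 3)%:R.
Proof.
rewrite rdenE !(coefB, coefD) coef1 coefCM coefX coefCM !coefXn; ring.
Qed.

(** Transfers a known equation to a new one through an identity of differences that [ring] can
    check. *)
Let eq_of_diff (R : zmodType) (a b c d : R) : a = b -> c - d = a - b -> c = d.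
Proof. by move=> -> /eqP; rewrite subrr subr_eq0 => /eqP. Qed.

Lemma r_init : [/\ r 0 = 0, r 1 = 1 & r 2 = 'X].
Proof.
have r0 : r 0 = 0.
  apply: (eq_of_diff _ _ _ _ _ (hr 0)).
  by rewrite big_ord_recl big_ord0 coef_rden /= subnn; ring.
have r1 : r 1%N = 1.
  apply: (eq_of_diff _ _ _ _ _ (hr 1)).
  by rewrite !big_ord_recl big_ord0 !coef_rden /= r0; ring.
split=> //; apply: (eq_of_diff _ _ _ _ _ (hr 2)).
by rewrite !big_ord_recl big_ord0 !coef_rden /= r0 r1; ring.
Qed.

Lemma r_rec k : r k.+3 = 'X * r k.+2 - 'X * r k.+1 + r k.
Proof.
apply: (eq_of_diff _ _ _ _ _ (hr k.+3)); rewrite 4!big_ord_recl big1 => [|j _].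
  by rewrite !coef_rden /= /bump /= !subSS !subn0; ring.
by rewrite coef_rden !lift0 !eqSS /=; ring.
Qed.

(* Linear evaluation of x^i as M_(N+i), on coefficients of index below K. *)
Definition motz_ev K N (p : {poly int}) : int :=
  \sum_(i < K) p`_i * (motzkin (N + i))%:Z.

Lemma motz_evD K N p q : motz_ev K N (p + q) = motz_ev K N p + motz_ev K N q.
Proof. by rewrite -big_split; apply: eq_bigr => i _; rewrite coefD mulrDl. Qed.

Lemma motz_evN K N p : motz_ev K N (- p) = - motz_ev K N p.
Proof. by rewrite -sumrN; apply: eq_bigr => i _; rewrite coefN mulNr. Qed.

Lemma motz_evX K N p : motz_ev K.+1 N ('X * p) = motz_ev K N.+1 p.
Proof.
rewrite /motz_ev big_ord_recl coefXM mul0r add0r; apply: eq_bigr => i _.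
by rewrite coefXM /= addnS.
Qed.

Lemma motz_ev1 K N : motz_ev K.+1 N 1 = (walks N 0 0)%:Z.
Proof.
rewrite walks_row big_ord_recl big_ord0 addn0 mwalks0.
rewrite /motz_ev big_ord_recl coef1 mul1r addn0 big1 ?addr0 // => i _.
by rewrite coef1 mul0r.
Qed.

(** Both sides satisfy the same third-order recurrence in [k]. Each factor ['X] lowers the cutoff
    [K] by one and raises [N] by one, hence the statement for all [K] and [N]. *)
Lemma motz_ev_r k K N : (k < K)%N -> motz_ev K N (r k.+1) = (walks N k 0)%:Z.
Proof.
have [r0 r1 r2] := r_init.
pose P k := forall K N, (k < K)%N -> motz_ev K N (r k.+1) = (walks N k 0)%:Z.
have P0 : P 0%N by move=> [|K'] N' // _; rewrite r1 motz_ev1.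
have P1 : P 1%N.
  move=> [|[|K']] N' // _; rewrite r2 -['X]mulr1 motz_evX motz_ev1.
  by rewrite /= !addn0.
suff: [/\ P k, P k.+1 & P k.+2] by case=> Pk _ _; apply: Pk.
elim: k => [|k [Pk Pk1 Pk2]].
  split=> // -[|K'] N' // K'2; rewrite r_rec r0 addr0 motz_evD motz_evN !motz_evX.
  (* As [r 0] vanishes, the case of [r 3] needs the dual recurrence at the origin in place of
     [walks_row_step]. *)
  rewrite P1 // P0 1?ltnW // [walks N'.+1 0 0]walks_dual.
  by rewrite /= !addn0 PoszD addrK.
split=> // -[|K'] N' // K'3; rewrite r_rec !motz_evD motz_evN !motz_evX.
rewrite Pk2 // Pk1 1?ltnW // Pk; last by lia.
by have := walks_row_step N' k; lia.
Qed.

End MotzkinFunctional.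

(** * Summation over outer shapes containing a single row *)

Theorem theorem2p1 (r : nat -> {poly int}) (hr : r_gf_spec r) (k n : nat) :
  (1 <= k)%N -> (k - 1 <= n)%N ->
  ((\sum_(a < n.+1) \sum_(b < n.+1) \sum_(c < n.+1)
      if [&& (c <= b)%N, (b <= a)%N, (a + b + c == n)%N & (k - 1 <= a)%N]
      then nsyt (part3 a b c) (part3 (k - 1) 0 0) else 0)%N)%:Z
  = \sum_(i < k) (r k)`_i * (motzkin (i + n.+1 - k))%:Z.
Proof.
case: k => // k _; rewrite subn1 /= => le_kn.
transitivity (motz_ev k.+1 (n - k) (r k.+1)); last first.
  by apply: eq_bigr => i _; congr (_ * (motzkin _)%:Z); lia.
rewrite (motz_ev_r _ hr) //; congr Posz.
(* The inner shape [(k, 0, 0)], with [k] already lowered by one, starts the walk at [p = k],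
   [q = 0]. *)
have := ntab_walks (n - k) n k 0 0 isT isT.
rewrite subn0 => <-; last lia.
rewrite pair_big pair_big /=; apply: eq_bigr => -[[a b] c] _ /=.
rewrite !andbT; case: ifP => // /and4P[_ _ /eqP Eabc _].
rewrite nsytE /skew_size !sumn_part3 Eabc !addn0.
by apply: eq_nskew => i; rewrite nth_part3.
Qed.
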